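(* For all integers $m, n \geq 1$ the following hold: (1) $Dph_n(\mathbb N) = Dph_m(\mathbb N)$ if and only if $n = m$. (2) $Dph_n(\mathbb N) \subseteq Dph_m(\mathbb N)$ if and only if $n \mid m$. The same two statements hold for the family $(Dph_n(\mathbb Z))_{n\ge 1}$ (that is, with $\mathbb N$ replaced by $\mathbb Z$ throughout) and for the family $(Dph_n(\mathbb Q))_{n \ge 1}$ (that is, with $\mathbb N$ replaced by $\mathbb Q$ throughout).
   Context: $\mathbb N$ denotes the natural numbers including $0$. For $R \in \{\mathbb N, \mathbb Z, \mathbb Q\}$, $M_n(R)$ is the set of $n\times n$ matrices with entries in $R$. $\mathbb Z[X_1,\dots,X_k]$ denotes here the ring of non-commutative polynomials with integer coefficients in the variables $X_1,\dots,X_k$ (the free associative unital ring; the variables do not commute with each other). Such a polynomial is evaluated at a tuple of $n\times n$ matrices using matrix addition and multiplication, where an integer $c$ occurring as a coefficient or as a free term is interpreted as $cI_n$, with $I_n$ the identity matrix; $0$ is interpreted as the zero matrix. A system of equations is a positive existential sentence of the form $S: \exists X_1,\dots,X_k\; P_1(X_1,\dots,X_k)=0 \wedge \dots \wedge P_s(X_1,\dots,X_k)=0$, where $P_1,\dots,P_s \in \mathbb Z[X_1,\dots,X_k]$ are non-commutative polynomials ($k$ and $s$ are arbitrary). $Dph_n(R)$ denotes the set of all systems of equations that are satisfiable in $M_n(R)$, i.e. for which there are $X_1,\dots,X_k\in M_n(R)$ satisfying all the equations. *)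

(* Defs.v *)
From mathcomp Require Import all_boot all_order all_algebra.
From mathcomp Require Import finmap classical_sets.
From mathcomp.multinomials Require Import monalg.
Set Implicit Arguments.
Unset Strict Implicit.
Unset Printing Implicit Defensive.

Import GRing.Theory.

Local Open Scope classical_set_scope.
Local Open Scope ring_scope.

(* Z[X_1, ..., X_k] with non-commuting variables: the monoid algebra over Z of
   the free monoid on k letters; monomials are words in the variables. *)
Notation ncpoly k := {malg int[{fmonom 'I_k}]}.

(* This is the sum defining monalg.mmap, which cannot be used here as it
   requires a nontrivial ring, whereas 'M[R]_n is one only for n = _.+1.
   In S := 'M[R]_n, c%:~R is the scalar matrix c I_n, and the empty word is
   sent to I_n. *)
Definition nceval (S : pzRingType) (k : nat) (x : 'I_k -> S) (P : ncpoly k) : S :=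
  \sum_(w <- msupp P) (P@_w)%:~R * \prod_(i <- w) x i.

Record diosys := DioSys { nvars : nat; eqns : seq (ncpoly nvars) }.

Definition Dph (R : pzRingType) (n : nat) : set diosys :=
  [set S | exists X : 'I_(nvars S) -> 'M[R]_n,
     forall P, P \in eqns S -> nceval X P = 0].

(* nat is not a ring and the coefficients may be negative: the equations are
   evaluated in 'M[int]_n, the unknowns ranging over 'M[nat]_n. *)
Definition DphN (n : nat) : set diosys :=
  [set S | exists X : 'I_(nvars S) -> 'M[nat]_n,
     forall P, P \in eqns S -> nceval (fun i => map_mx Posz (X i)) P = 0].

(* Main.v *)
From HB Require Import structures.
Require Import Defs.
From mathcomp Require Import all_boot all_order all_algebra.
From mathcomp Require Import classical_sets.
From mathcomp.multinomials Require Import monalg.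
Import GRing.Theory Num.Theory.
Set Implicit Arguments.
Unset Strict Implicit.
Unset Printing Implicit Defensive.
Local Open Scope classical_set_scope.
Local Open Scope ring_scope.

(** If n divides m, sending A to the block-diagonal matrix with m / n copies
    of A is a unital ring morphism from n x n to m x m matrices that keeps
    nonnegative entries nonnegative; it carries solutions to solutions, so
    every system solvable in size n is solvable in size m.

    Conversely, consider the system in two unknowns f and a
<<
      f ^ n = 0,     \sum_(i < n) f ^ i * a * f ^ (n - 1 - i) = 1.
>>
    In size n it is solved by 0-1 matrices: f the nilpotent shift and a the
    matrix unit in the bottom left corner, the terms of the sum being the n
    diagonal matrix units ([size_system_sol]).  Suppose it has a solution in
    rational m x m matrices, and put e = a * f ^ (n - 1).  By cyclicity every
    term of the sum has the trace of e, so that m = n * tr e.  Multiplying the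
    second equation by f ^ (n - 1) on the left kills all the terms but the
    first, which gives f ^ (n - 1) * a * f ^ (n - 1) = f ^ (n - 1); hence e is
    idempotent, its trace is its rank, an integer, and n divides m
    ([size_system_dvd]).

    This system lies in every family at size n already over the natural
    numbers, and excludes sizes that are not multiples of n even over the
    rationals: it separates sizes in the three families at once.  Equality of
    two sets of systems then means that each size divides the other. *)

(** * Evaluation of non-commutative polynomials *)

Lemma nceval_rmorph (S T : pzRingType) (h : {rmorphism S -> T}) k
    (x : 'I_k -> S) (P : ncpoly k) :
  nceval (fun i => h (x i)) P = h (nceval x P).
Proof.
rewrite /nceval rmorph_sum; apply: eq_bigr => w _.
by rewrite rmorphM rmorph_int rmorph_prod.
Qed.

Lemma eq_nceval (S : pzRingType) k (x y : 'I_k -> S) (P : ncpoly k) :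
  x =1 y -> nceval x P = nceval y P.
Proof.
move=> exy; apply: eq_bigr => w _; congr (_ * _).
by apply: eq_bigr => i _.
Qed.

(** Over a nontrivial ring the evaluation is an instance of the generic
    monoid-algebra map, which supplies its additivity and its value on words. *)
Lemma ncevalE (S : nzRingType) k (x : 'I_k -> S) (P : ncpoly k) :
  nceval x P = mmap intr (fun w : {fmonom 'I_k} => \prod_(i <- w) x i) P.
Proof. by []. Qed.

Lemma ncevalB (S : nzRingType) k (x : 'I_k -> S) :
  {morph nceval x : P Q / P - Q}.
Proof. by move=> P Q; rewrite !ncevalE mmapB. Qed.

Lemma nceval_sum (S : nzRingType) k (x : 'I_k -> S) (I : finType)
    (P : I -> ncpoly k) :
  nceval x (\sum_i P i) = \sum_i nceval x (P i).
Proof. by rewrite ncevalE raddf_sum. Qed.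

Definition word_poly k (s : seq 'I_k) : ncpoly k := << FMonom s >>.

Lemma nceval_word (S : nzRingType) k (x : 'I_k -> S) (s : seq 'I_k) :
  nceval x (word_poly s) = \prod_(i <- s) x i.
Proof. by rewrite ncevalE mmapU mul1r. Qed.

(** * The block-diagonal embedding *)

Section BlockDiagonal.

Variables (R : pzRingType) (n q : nat).

Definition diag_copies (A : 'M[R]_n) : 'M[R]_(\sum_(i < q) n) :=
  \mxdiag_(i < q) A.

Fact diag_copies_is_zmod_morphism : zmod_morphism diag_copies.
Proof. by move=> A B; rewrite /diag_copies -mxdiagB. Qed.

Fact diag_copies_is_monoid_morphism : monoid_morphism diag_copies.
Proof.
split=> [|A B]; first exact: mxdiagZ.
rewrite /diag_copies [X in _ = _ * X]/mxdiag.
rewrite -[RHS]/(_ *m _) mul_mxdiag_mxblock; apply: eq_mxblock => i j.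
by case: eqVneq => _; rewrite ?conform_mx_id // mulmx0.
Qed.

HB.instance Definition _ :=
  GRing.isZmodMorphism.Build _ _ diag_copies diag_copies_is_zmod_morphism.
HB.instance Definition _ :=
  GRing.isMonoidMorphism.Build _ _ diag_copies diag_copies_is_monoid_morphism.

End BlockDiagonal.

Lemma sum_ord_const_nat q n : (\sum_(i < q) n = q * n)%N.
Proof. by rewrite sum_nat_const card_ord. Qed.

Lemma Dph_dvd (R : pzRingType) n m : (n %| m)%N -> Dph R n `<=` Dph R m.
Proof.
case/dvdnP=> q ->; rewrite -sum_ord_const_nat => S [X solX].
exists (fun i => diag_copies q (X i)) => P PS.
by rewrite nceval_rmorph (solX P PS) rmorph0.
Qed.

Lemma map_diag_copies n q (A : 'M[nat]_n) :
  map_mx Posz (\mxdiag_(i < q) A) = diag_copies q (map_mx Posz A).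
Proof.
apply/matrixP=> i j; rewrite /diag_copies /mxdiag !mxE.
by case: eqVneq => _; rewrite ?conform_mx_id !mxE.
Qed.

Lemma DphN_dvd n m : (n %| m)%N -> DphN n `<=` DphN m.
Proof.
case/dvdnP=> q ->; rewrite -sum_ord_const_nat => S [X solX].
exists (fun i => \mxdiag_(j < q) X i) => P PS.
rewrite (eq_nceval _ (fun i => map_diag_copies q (X i))).
by rewrite nceval_rmorph (solX P PS) rmorph0.
Qed.

Lemma DphN_sub_int n : DphN n `<=` Dph int n.
Proof. by move=> S [X solX]; exists (fun i => map_mx Posz (X i)). Qed.

Lemma Dph_int_sub_rat n : Dph int n `<=` Dph rat n.
Proof.
move=> S [X solX]; exists (fun i => map_mx intr (X i)) => P PS.
by rewrite nceval_rmorph (solX P PS) rmorph0.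
Qed.

Lemma DphN_sub_rat n : DphN n `<=` Dph rat n.
Proof. by move=> S /DphN_sub_int /Dph_int_sub_rat. Qed.

(** * A system forcing the size to be a multiple of n *)

(** The letter [ord0] is the nilpotent f, the letter [ord_max] is a. *)
Definition size_system (n : nat) : diosys :=
  @DioSys 2 [:: word_poly (nseq n ord0);
    \sum_(i < n) word_poly (nseq i ord0 ++ ord_max :: nseq (n.-1 - i) ord0)
      - word_poly [::]].

Lemma size_systemP (S : nzRingType) n (x : 'I_2 -> S) :
  (forall P, P \in eqns (size_system n) -> nceval x P = 0) <->
  x ord0 ^+ n = 0 /\
  \sum_(i < n) x ord0 ^+ i * x ord_max * x ord0 ^+ (n.-1 - i) = 1.
Proof.
have ev0 : nceval x (word_poly (nseq n ord0)) = x ord0 ^+ n.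
  by rewrite nceval_word big_nseq iter_mulr_1.
have ev1 : nceval x (\sum_(i < n)
      word_poly (nseq i ord0 ++ ord_max :: nseq (n.-1 - i) ord0)
      - word_poly [::]) =
    \sum_(i < n) x ord0 ^+ i * x ord_max * x ord0 ^+ (n.-1 - i) - 1.
  rewrite ncevalB nceval_sum [X in _ - X]nceval_word big_nil.
  congr (_ - _); apply: eq_bigr => i _.
  rewrite nceval_word big_cat /= big_cons !big_nseq !iter_mulr_1.
  by rewrite mulrA.
split=> [sol | [nilx sumx] P].
  split; first by rewrite -ev0 sol // mem_head.
  by apply/subr0_eq; rewrite -ev1 sol // !inE eqxx orbT.
by rewrite !inE => /orP[] /eqP ->; rewrite ?ev0 // ev1 sumx subrr.
Qed.

(** In a full-rank factorization E = C R, idempotence cancels to R C = 1, and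
    the trace of C R is that of R C, an identity matrix of size rank E. *)
Lemma mxtrace_idempotent (F : fieldType) m (E : 'M[F]_m) :
  E *m E = E -> \tr E = (\rank E)%:R.
Proof.
rewrite -{1 2 3}[E]mulmx_base -mulmxA => EE.
have /(row_full_inj (col_base_full E)) : col_base E *m
    (row_base E *m (col_base E *m row_base E)) = col_base E *m row_base E.
  exact: EE.
rewrite mulmxA -[in RHS](mul1mx (row_base E)).
move=> /(row_free_inj (row_base_free E)) RC1.
by rewrite -{1}[E]mulmx_base mxtrace_mulC RC1 mxtrace1.
Qed.

(** The rank of the idempotent a * f ^ (n - 1) is the quotient m / n. *)
Lemma size_system_dvd n m : (0 < m)%N ->
  Dph rat m (size_system n) -> (n %| m)%N.
Proof.
case: m => // m _ [X /size_systemP].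
move: (X ord0) (X ord_max) => {X} f a [nilf sum1].
have idem : (a * f ^+ n.-1) *m (a * f ^+ n.-1) = a * f ^+ n.-1.
  have {3}<- : f ^+ n.-1 * a * f ^+ n.-1 = f ^+ n.-1.
    (* f ^ n.-1 times the second equation: only the term i = 0 survives *)
    case: n nilf sum1 => [/eqP|n]; first by rewrite expr0 oner_eq0.
    move=> nilf sum1 /=; rewrite -[RHS]mulr1 -sum1 mulr_sumr big_ord_recl.
    rewrite expr0 mul1r subn0 big1 ?addr0 ?mulrA // => i _.
    by rewrite !mulrA -exprD addnS -addSn exprD nilf !mul0r.
  by rewrite -[LHS]/(_ * _) !mulrA.
have trS (i : 'I_n) : \tr (f ^+ i * a * f ^+ (n.-1 - i)) = \tr (a * f ^+ n.-1).
  rewrite -mulrA -[_ * (_ * _)]/(_ *m _) mxtrace_mulC -[_ *m _]/(_ * _).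
  rewrite -mulrA -exprD subnK //.
  by rewrite -ltnS (ltn_predK (ltn_ord i)).
have := congr1 mxtrace sum1; rewrite raddf_sum (eq_bigr _ (fun i _ => trS i)).
rewrite sumr_const card_ord (mxtrace_idempotent idem) mxtrace1 -mulrnA.
by move/eqP; rewrite eqr_nat => /eqP <-; rewrite dvdn_mull.
Qed.

Definition shift_mx n : 'M[int]_n.+1 := \matrix_(i, j) (j == i.+1 :> nat)%:R.

Lemma shift_mxX n k :
  shift_mx n ^+ k = \matrix_(i, j) (j == i + k :> nat)%N%:R.
Proof.
elim: k => [|k IHk].
  by apply/matrixP=> i j; rewrite !mxE addn0 eq_sym.
rewrite exprSr IHk; apply/matrixP=> i j; rewrite -[_ * _]/(_ *m _) !mxE.
case: (ltnP (i + k) n.+1) => [lt_ikn | le_nik].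
  rewrite (bigD1 (Ordinal lt_ikn)) //= big1 => [|l /negPf ne_l].
    by rewrite !mxE /= eqxx mul1r addr0 addnS.
  by rewrite mxE -[(l == _ :> nat)]/(l == Ordinal lt_ikn) ne_l mul0r.
rewrite big1 => [|l _]; last first.
  by rewrite mxE (ltn_eqF (leq_trans (ltn_ord l) le_nik)) mul0r.
by rewrite addnS (ltn_eqF (leq_trans (ltn_ord j) _)) // leqW.
Qed.

(** A matrix unit factors as a column times a row, which makes the product
    the outer product of column p of A and row q of B. *)
Lemma mul_delta_mxE (R : pzRingType) n (A B : 'M[R]_n.+1) p q i j :
  (A * delta_mx p q * B) i j = A i p * B q j.
Proof.
rewrite -(mul_delta_mx (0 : 'I_1)) -[_ * _]/(_ *m _ *m _) mulmxA -colE.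
by rewrite -mulmxA -rowE !mxE big_ord1 !mxE.
Qed.

Lemma size_system_sol n : (0 < n)%N -> DphN n (size_system n).
Proof.
case: n => // n _.
pose f : 'M[nat]_n.+1 := \matrix_(i, j) nat_of_bool (j == i.+1 :> nat).
pose a : 'M[nat]_n.+1 :=
  \matrix_(i, j) nat_of_bool ((i == ord_max) && (j == ord0)).
pose Y (i : 'I_2) : 'M[int]_n.+1 :=
  if i == ord0 then shift_mx n else delta_mx ord_max ord0.
have XY i : map_mx Posz (if i == ord0 then f else a) = Y i.
  rewrite /Y; case: ifP => _; apply/matrixP=> j k; rewrite !mxE.
    by case: (_ == _).
  by case: (_ && _).
exists (fun i => if i == ord0 then f else a) => P PS.
rewrite (eq_nceval P XY); move: P PS; apply/(size_systemP n.+1 Y).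
rewrite {XY}/Y /=; split.
  apply/matrixP=> i j; rewrite shift_mxX !mxE.
  by rewrite (ltn_eqF (leq_trans (ltn_ord j) (leq_addl _ _))).
(* the k-th term is the diagonal matrix unit at index rev_ord k *)
apply/matrixP=> i j; rewrite summxE (bigD1 (rev_ord i)) //= big1 => [|k ne_k].
  rewrite mul_delta_mxE !shift_mxX !mxE addr0 /= subSS add0n.
  by rewrite subnKC -1?ltnS // eqxx mul1r subKn -1?ltnS // eq_sym.
rewrite mul_delta_mxE !shift_mxX !mxE /=.
suff /negPf -> : (n != i + k)%N by rewrite mul0r.
apply: contra ne_k => /eqP def_n; apply/eqP/val_inj => /=.
by rewrite subSS; apply: (canRL (addKn i)); rewrite -def_n.
Qed.

(** * Comparison of the sizes *)

(** The test system is solvable over the smallest family and obstructed over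
    the largest one, so a single argument covers every family in between. *)
Lemma Dph_family_classification (D : nat -> set diosys) :
  (forall n, DphN n `<=` D n) -> (forall n, D n `<=` Dph rat n) ->
  (forall n m, (n %| m)%N -> D n `<=` D m) ->
  forall n m, (0 < n)%N -> (0 < m)%N ->
    (D n = D m <-> n = m) /\ (D n `<=` D m <-> (n %| m)%N).
Proof.
move=> ND DQ dvdD.
have sub_dvd n m : (0 < n)%N -> (0 < m)%N -> D n `<=` D m -> (n %| m)%N.
  move=> n_gt0 m_gt0 sD; apply: (size_system_dvd m_gt0).
  exact/DQ/sD/ND/size_system_sol.
move=> n m n_gt0 m_gt0; split; split; last exact: dvdD.
- by move=> eqD; apply/eqP; rewrite eqn_dvd !sub_dvd // eqD.
- by move=> ->.
- exact: sub_dvd.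
Qed.

Theorem theorem1p1 (m n : nat) (hm : (1 <= m)%N) (hn : (1 <= n)%N) :
  ((DphN n = DphN m <-> n = m) /\
   (DphN n `<=` DphN m <-> (n %| m)%N)) /\
  ((Dph int n = Dph int m <-> n = m) /\
   (Dph int n `<=` Dph int m <-> (n %| m)%N)) /\
  ((Dph rat n = Dph rat m <-> n = m) /\
   (Dph rat n `<=` Dph rat m <-> (n %| m)%N)).
Proof.
split; [| split].
- apply: (Dph_family_classification (D := DphN)) => //.
  + by move=> k S.
  + exact: DphN_sub_rat.
  + exact: DphN_dvd.
- apply: (Dph_family_classification (D := Dph int)) => //.
  + exact: DphN_sub_int.
  + exact: Dph_int_sub_rat.
  + exact: Dph_dvd.
- apply: (Dph_family_classification (D := Dph rat)) => //.
  + exact: DphN_sub_rat.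
  + by move=> k S.
  + exact: Dph_dvd.
Qed.
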